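(* Let $(P,\preceq,\wedge)$ be a meet semilattice and let $f,g:P\to\mathbb{R}$ be positive definite functions. Then: (i) $af$ is positive definite for any scalar $a\geq 0$; (ii) $f+g$ is positive definite; (iii) the pointwise product $fg$ is positive definite.
   Context: A meet semilattice $(P,\preceq,\wedge)$ is a nonempty poset in which every two elements $x,y$ have a greatest lower bound $x\wedge y$. For a finite nonempty set $S=\{x_1,\ldots,x_n\}\subset P$ and $f:P\to\mathbb{R}$, the meet matrix $(S)_f$ is the $n\times n$ real matrix with entries $((S)_f)_{i,j}=f(x_i\wedge x_j)$. The function $f$ is called positive definite if $(S)_f$ is positive semidefinite for every finite nonempty $S\subset P$. *)

(* Defs.v *)
From mathcomp Require Import all_boot all_order all_algebra.
From mathcomp Require Import reals.

Set Implicit Arguments.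
Unset Strict Implicit.
Unset Printing Implicit Defensive.

Import Order.TTheory GRing.Theory Num.Theory.
Local Open Scope ring_scope.

Definition psdmx (R : realType) (n : nat) (A : 'M[R]_n) : Prop :=
  A^T = A /\ forall v : 'cV[R]_n, 0 <= (v^T *m A *m v) 0 0.

Definition meet_mx (d : Order.disp_t) (P : meetSemilatticeType d)
    (R : realType) (n : nat) (f : P -> R) (s : n.-tuple P) : 'M[R]_n :=
  \matrix_(i, j) f (tnth s i `&` tnth s j)%O.

(* The finite nonempty subsets {x_1, ..., x_n} of P are represented by their
   enumerations, i.e., the nonempty duplicate-free tuples. *)
Definition posdef_fun (d : Order.disp_t) (P : meetSemilatticeType d)
    (R : realType) (f : P -> R) : Prop :=
  forall (n : nat) (s : n.-tuple P), (0 < n)%N -> uniq s -> psdmx (meet_mx f s).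

(* Main.v *)
Require Import Defs.
From mathcomp Require Import all_boot all_order all_algebra.
From mathcomp Require Import reals.
From mathcomp Require Import ring.

(* Closure under products is the Schur product theorem.  Subtracting from a positive
   semidefinite matrix the rank one matrix of a nonzero pivot leaves a positive
   semidefinite matrix with fewer nonzero diagonal entries, so such a matrix is
   a sum of matrices w w^T; and the entrywise product of A with w w^T has at v
   the quadratic form of A at the entrywise product of w and v. *)

Set Implicit Arguments.
Unset Strict Implicit.
Unset Printing Implicit Defensive.

Import Order.TTheory GRing.Theory Num.Theory.
Local Open Scope ring_scope.

Lemma quad_formE (R : comPzRingType) (n : nat) (A : 'M[R]_n) (v : 'cV[R]_n) :
  (v^T *m A *m v) 0 0 = \sum_i \sum_j A i j * (v i 0 * v j 0).
Proof.
rewrite mxE exchange_big; apply: eq_bigr => j _ /=.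
rewrite mxE mulr_suml; apply: eq_bigr => i _.
by rewrite mxE; ring.
Qed.

(** Symmetry of [A] merges the two cross terms. Along a coordinate direction the form is thus a
    quadratic polynomial in [t], and the lemmas below choose [t] to exploit its sign. *)
Lemma quad_formDZ_delta (R : comPzRingType) (n : nat) (A : 'M[R]_n)
    (v : 'cV[R]_n) (i : 'I_n) (t : R) : A^T = A ->
  ((v + t *: delta_mx i 0)^T *m A *m (v + t *: delta_mx i 0)) 0 0 =
  (v^T *m A *m v) 0 0 + t * (A *m v) i 0 *+ 2 + t ^+ 2 * A i i.
Proof.
move=> symA.
pose e : 'cV[R]_n := delta_mx i 0.
have eu (u : 'cV[R]_n) : (e^T *m u) 0 0 = u i 0 by rewrite trmx_delta -rowE mxE.
have ve : (v^T *m (A *m e)) 0 0 = (A *m v) i 0.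
  (* A 1 x 1 matrix and its transpose have the same entry, so both cross terms reduce to
     [(A *m v) i 0]. *)
  rewrite -eu -[in RHS]symA -[e^T *m _]trmxK [RHS]mxE.
  by rewrite !trmx_mul !trmxK mulmxA.
have ee : (A *m e) i 0 = A i i by rewrite -colE mxE.
have trE : (v + t *: e)^T = v^T + t *: e^T by rewrite linearD linearZ.
have addE (B C : 'M[R]_1) : (B + C) 0 0 = B 0 0 + C 0 0 by rewrite mxE.
have scaleE (B : 'M[R]_1) : (t *: B) 0 0 = t * B 0 0 by rewrite mxE.
rewrite -/e trE -!mulmxA !(mulmxDl, mulmxDr) -!scalemxAr -!scalemxAl.
by rewrite !(addE, scaleE) ve !eu ee; ring.
Qed.

Lemma psdmx_diag_ge0 (R : realType) (n : nat) (A : 'M[R]_n) (i : 'I_n) :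
  psdmx A -> 0 <= A i i.
Proof.
by case=> _ /(_ (delta_mx i 0)); rewrite trmx_delta -rowE -colE !mxE.
Qed.

(** When [A i i = 0], the form at [delta_mx j 0 + t *: delta_mx i 0] is affine in [t] with slope
    [2 * A i j]; a nonzero slope would make it negative somewhere. *)
Lemma psdmx_diag_eq0 (R : realType) (n : nat) (A : 'M[R]_n) (i j : 'I_n) :
  psdmx A -> A i i = 0 -> A i j = 0.
Proof.
move=> [symA posA] Aii0; apply/eqP/negPn/negP => Aij_neq0.
(* This coefficient solves [A j j + 2 * t * A i j = -1]. *)
have := posA (delta_mx j 0 + (- (A j j + 1) / (2 * A i j)) *: delta_mx i 0).
rewrite quad_formDZ_delta // Aii0 trmx_delta -rowE -!colE !mxE.
suff -> : A j j + - (A j j + 1) / (2 * A i j) * A i j *+ 2 +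
  (- (A j j + 1) / (2 * A i j)) ^+ 2 * 0 = -1 by rewrite oppr_ge0 ler10.
by field.
Qed.

(** Completing the square: the form of the reduced matrix at [v] is the minimum over [t] of the form
    of [A] at [v + t *: delta_mx i 0], hence nonnegative. *)
Lemma psdmx_sub_pivot (R : realType) (n : nat) (A : 'M[R]_n) (i : 'I_n) :
  psdmx A -> 0 < A i i -> psdmx (A - (A i i)^-1 *: (col i A *m (col i A)^T)).
Proof.
move=> [symA posA] Aii_gt0; split.
  by rewrite linearB linearZ /= trmx_mul trmxK symA.
(* The coefficient is the minimizer in [t]. *)
move=> v; have := posA (v + (- (A *m v) i 0 / A i i) *: delta_mx i 0).
have cv : ((col i A)^T *m v) 0 0 = (A *m v) i 0.
  by rewrite tr_col symA -row_mul mxE.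
have vc : (v^T *m col i A) 0 0 = (A *m v) i 0.
  by rewrite -cv -[in RHS](trmxK v) -trmx_mul [RHS]mxE.
have -> : (v^T *m (A - (A i i)^-1 *: (col i A *m (col i A)^T)) *m v) 0 0 =
    (v^T *m A *m v) 0 0 - (A i i)^-1 * (A *m v) i 0 ^+ 2.
  rewrite mulmxBr mulmxBl -scalemxAr -scalemxAl mulmxA [LHS]mxE; congr (_ + _).
  rewrite [LHS]mxE [in LHS]mxE; congr (- (_ * _)).
  by rewrite -(mulmxA _ _ v) [LHS]mxE big_ord1 cv vc.
rewrite quad_formDZ_delta //.
have completed_square (q m a : R) : a != 0 ->
    q + - m / a * m *+ 2 + (- m / a) ^+ 2 * a = q - a^-1 * m ^+ 2.
  by move=> a_neq0; field.
by rewrite completed_square ?gt_eqF.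
Qed.

Lemma psdmx_sum_rank1 (R : realType) (n : nat) (A : 'M[R]_n) :
  psdmx A -> exists s : seq 'cV[R]_n, A = \sum_(w <- s) w *m w^T.
Proof.
have [k] := ubnP #|[set i | A i i != 0]|; elim: k A => // k IHk A.
rewrite ltnS => leAk psdA.
have [i Aii_neq0|diag0] := pickP (fun i => A i i != 0); last first.
  exists [::]; rewrite big_nil; apply/matrixP => i j; rewrite mxE.
  by apply: psdmx_diag_eq0 => //; apply/eqP/negbFE/diag0.
have Aii_gt0 : 0 < A i i by rewrite lt0r Aii_neq0 psdmx_diag_ge0.
(* The square root makes [w *m w^T] exactly the pivot matrix to subtract. *)
set w := (Num.sqrt (A i i))^-1 *: col i A.
have wwE : w *m w^T = (A i i)^-1 *: (col i A *m (col i A)^T).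
  rewrite linearZ /= -scalemxAl -scalemxAr scalerA -invfM -expr2.
  by rewrite sqr_sqrtr // ltW.
have [|s As] := IHk _ _ (psdmx_sub_pivot psdA Aii_gt0); last first.
  by exists (w :: s); rewrite big_cons -As wwE addrC subrK.
(* The count drops strictly: a zero diagonal entry [A j j] forces [A j i = 0] and so stays zero,
   while the entry at the pivot [i] becomes zero. *)
apply: leq_trans leAk; apply: proper_card; apply/properP; split.
  apply/subsetP => j; rewrite !inE; apply: contraNneq => Ajj0.
  by rewrite !mxE big_ord1 !mxE (psdmx_diag_eq0 _ psdA Ajj0) Ajj0 mul0r mulr0 subr0.
exists i; rewrite !inE // !mxE big_ord1 !mxE mulrA mulVf // mul1r subrr.
by rewrite eqxx.
Qed.

Lemma psdmx_schur_product (R : realType) (n : nat) (A B : 'M[R]_n) :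
  psdmx A -> psdmx B -> psdmx (\matrix_(i, j) (A i j * B i j)).
Proof.
move=> [symA posA] psdB; have [symB _] := psdB.
split.
  apply/matrixP => i j; rewrite !mxE -[in LHS]symA -[in LHS]symB.
  by rewrite !mxE.
move=> v; have [s Bs] := psdmx_sum_rank1 psdB.
rewrite quad_formE.
suff -> : \sum_i \sum_j (\matrix_(i, j) (A i j * B i j)) i j * (v i 0 * v j 0) =
  \sum_(w <- s) let u := \col_i (w i 0 * v i 0) in (u^T *m A *m u) 0 0.
  by apply: sumr_ge0 => w _; apply: posA.
(* Moving the sum over [w] innermost leaves an identity for each pair [i], [j], where [B i j] is the
   sum of the [w i 0 * w j 0]. *)
under [RHS]eq_bigr => w _ do rewrite /= quad_formE.
rewrite [RHS]exchange_big /=; apply: eq_bigr => i _.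
rewrite [RHS]exchange_big /=; apply: eq_bigr => j _.
rewrite mxE Bs summxE mulr_sumr mulr_suml; apply: eq_bigr => w _.
by rewrite !mxE big_ord1 !mxE; ring.
Qed.

Lemma psdmxZ (R : realType) (n : nat) (a : R) (A : 'M[R]_n) :
  0 <= a -> psdmx A -> psdmx (a *: A).
Proof.
move=> a0 [symA posA]; split=> [|v]; first by rewrite linearZ /= symA.
by rewrite -scalemxAr -scalemxAl mxE mulr_ge0.
Qed.

Lemma psdmxD (R : realType) (n : nat) (A B : 'M[R]_n) :
  psdmx A -> psdmx B -> psdmx (A + B).
Proof.
move=> [symA posA] [symB posB]; split=> [|v]; first by rewrite linearD /= symA symB.
by rewrite mulmxDr mulmxDl mxE addr_ge0.
Qed.

Theorem theorem2p7 (R : realType) (d : Order.disp_t)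
    (P : meetSemilatticeType d) (P_nonempty : inhabited P) (f g : P -> R)
    (f_pd : posdef_fun f) (g_pd : posdef_fun g) :
  [/\ forall a : R, 0 <= a -> posdef_fun (fun x => a * f x),
      posdef_fun (fun x => f x + g x) &
      posdef_fun (fun x => f x * g x)].
Proof.
(* For fixed [s], pointwise operations on functions become entrywise operations on meet matrices, so
   each claim follows from its matrix counterpart. *)
split=> [a a0||] n s n0 us; have psdf := f_pd n s n0 us; have psdg := g_pd n s n0 us.
- suff -> : meet_mx (fun x => a * f x) s = a *: meet_mx f s by apply: psdmxZ.
  by apply/matrixP => i j; rewrite !mxE.
- suff -> : meet_mx (fun x => f x + g x) s = meet_mx f s + meet_mx g s.
    exact: psdmxD.
  by apply/matrixP => i j; rewrite !mxE.
- suff -> : meet_mx (fun x => f x * g x) s =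
      \matrix_(i, j) (meet_mx f s i j * meet_mx g s i j).
    exact: psdmx_schur_product.
  by apply/matrixP => i j; rewrite !mxE.
Qed.
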